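(* For every $k \ge 2$, $A^{\mathbf{R}}_k$ is contained in the ideal $$\big(2qz_1^2 - (1 + q_1 + q_2 - 2q + q_1q + q_2q + q^2)z_1z_2 + 2qz_2^2,\ (1 - q_1)(1 - q_2)(1 - q)(z_1 + z_2)\big)$$ of $\mathbf{R}[z_1^{\pm 1}, \dots, z_k^{\pm 1}]$ generated by the two displayed elements.
   Context: Let $\mathbf{R} = \mathbb{C}[q_1^{\pm 1}, q_2^{\pm 1}]$ and $q = q_1 q_2$. Let $V_k = \mathbf{R}[z_1^{\pm 1},\dots,z_k^{\pm 1}]^{S_k}$ be the ring of symmetric Laurent polynomials in $z_1,\dots,z_k$ over $\mathbf{R}$, and $V = \bigoplus_{k\ge 0} V_k$. The shuffle product $* : V_k \times V_l \to V_{k+l}$ is $$(P*Q)(z_1,\dots,z_{k+l}) = \frac{1}{k!\,l!}\,\mathrm{Sym}\Big[P(z_1,\dots,z_k)\,Q(z_{k+1},\dots,z_{k+l}) \prod_{1\le i\le k<j\le k+l} \omega(z_i,z_j)\Big],$$ where $\mathrm{Sym}(F(z_1,\dots,z_m)) = \sum_{\sigma\in S_m} F(z_{\sigma(1)},\dots,z_{\sigma(m)})$ and $$\omega(z_i,z_j) = \frac{(z_i - q z_j)(z_j - q_1 z_i)(z_j - q_2 z_i)}{z_i - z_j}.$$ The shuffle product is associative. The integral shuffle algebra $A^{\mathbf{R}} \subset V$ is the $\mathbf{R}$-algebra generated, under the product $*$, by the elements $z_1^d \in V_1$, $d\in\mathbb{Z}$; and $A^{\mathbf{R}}_k = A^{\mathbf{R}}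 \cap V_k$. *)

(* Defs.v *)
From HB Require Import structures.
From mathcomp Require Import all_boot all_order all_fingroup all_algebra.
From mathcomp Require Import complex.
From mathcomp Require Import mpoly.
From mathcomp Require Import reals.

Set Implicit Arguments.
Unset Strict Implicit.
Unset Printing Implicit Defensive.

Import GRing.Theory.
Local Open Scope ring_scope.

(* Laurent polynomial rings are realised inside fields of rational functions:
   the shuffle product has the denominators z_i - z_j, which only cancel after
   symmetrization, so it is computed in the field F(z_1, ..., z_n).
   Variables are numbered from 0: [zvar i], for i : 'I_n, is z_{i+1}. *)
Section RationalFunctions.
Variable F : fieldType.

Definition ratfun (n : nat) : fieldType := {fraction {mpoly F[n]}}.

Definition rconst n (c : F) : ratfun n := FracField.tofrac (mpolyC n c).

Fact rconst_is_zmod_morphism n : zmod_morphism (@rconst n).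
Proof. by move=> x y; rewrite /rconst mpolyCB tofracB. Qed.

HB.instance Definition _ n := GRing.isZmodMorphism.Build F (ratfun n)
  (@rconst n) (@rconst_is_zmod_morphism n).

Fact rconst_is_monoid_morphism n : monoid_morphism (@rconst n).
Proof.
by split=> [|x y]; rewrite /rconst ?mpolyC1 ?tofrac1 // mpolyCM tofracM.
Qed.

HB.instance Definition _ n := GRing.isMonoidMorphism.Build F (ratfun n)
  (@rconst n) (@rconst_is_monoid_morphism n).

Definition zvar n (i : 'I_n) : ratfun n := FracField.tofrac 'X_i.

(* P(v_1, ..., v_m).  The value is computed on one representative num/den of P,
   so it does not depend on the choice, and is meaningful, only if the v_i are
   algebraically independent over F.  It is used below only when the v_i are
   pairwise distinct variables. *)
Definition rsubst m n (v : 'I_m -> ratfun n) (P : ratfun m) : ratfun n :=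
  mmap (@rconst n) v \n_(generic_quotient.repr P)
  / mmap (@rconst n) v \d_(generic_quotient.repr P).

(* S[z_1^{+-1}, ..., z_n^{+-1}] for a subring S of F: the quotients of a
   polynomial with coefficients in S by a monomial. *)
Definition laurent (S : F -> Prop) n (P : ratfun n) : Prop :=
  exists (p : {mpoly F[n]}) (m : 'X_{1..n}),
    (forall m', S p@_m') /\
    P = FracField.tofrac p / FracField.tofrac 'X_[m].

Definition rsymmetric n (P : ratfun n) : Prop :=
  forall s : 'S_n, rsubst (fun i => zvar (s i)) P = P.

Definition Sym n (P : ratfun n) : ratfun n :=
  \sum_(s : 'S_n) rsubst (fun i => zvar (s i)) P.

End RationalFunctions.

Arguments rconst {F} n c.
Arguments zvar {F n} i.

Section ShuffleAlgebra.
Variable R : realType.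

(* The field C(q_1, q_2) *)
Definition qfield : fieldType := @ratfun R[i] 2.

Definition q1 : qfield := zvar (ord0 : 'I_2).
Definition q2 : qfield := zvar (ord_max : 'I_2).
Definition q : qfield := q1 * q2.

(* The ring C[q_1^{+-1}, q_2^{+-1}] *)
Definition Rq : qfield -> Prop := @laurent R[i] (fun=> True) 2.

(* C(q_1, q_2)(z_1, ..., z_n) *)
Definition zfield (n : nat) : fieldType := @ratfun qfield n.

(* Rq[z_1^{+-1}, ..., z_n^{+-1}] *)
Definition laurentR n : zfield n -> Prop := @laurent qfield Rq n.

(* V_k *)
Definition symLaurent n (P : zfield n) : Prop := laurentR P /\ rsymmetric P.

Definition omega n (x y : zfield n) : zfield n :=
  (x - rconst n q * y) * (y - rconst n q1 * x) * (y - rconst n q2 * x)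
  / (x - y).

Definition shuffle k l (P : zfield k) (Q : zfield l) : zfield (k + l) :=
  (k`!%:R * l`!%:R)^-1
  * Sym (rsubst (fun i => zvar (lshift l i)) P
         * rsubst (fun j => zvar (rshift k j)) Q
         * \prod_(i < k) \prod_(j < l)
             omega (zvar (lshift l i)) (zvar (rshift k j))).

(* Families (P_k)_k with one component in each C(q_1, q_2)(z_1, ..., z_k); the
   direct sum of the V_k is the set [V] of families below. *)
Definition graded := forall n : nat, zfield n.

Definition V (f : graded) : Prop :=
  (exists N, forall n, (N <= n)%N -> f n = 0) /\ (forall n, symLaurent (f n)).

(* The family with P in degree k and 0 in the other degrees *)
Definition indeg k (P : zfield k) : graded := fun n =>
  if @eqP _ k n is ReflectT e then ecast m (zfield m) e P else 0.

Definition gadd (f g : graded) : graded := fun n => f n + g n.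

Definition gscale (c : qfield) (f : graded) : graded :=
  fun n => rconst n c * f n.

(* Bilinear extension of the shuffle product: only the pairs with i + j = n
   contribute in degree n. *)
Definition gmul (f g : graded) : graded := fun n =>
  \sum_(i < n.+1) \sum_(j < n.+1) indeg (shuffle (f i) (g j)) n.

Definition gone : graded := indeg (1 : zfield 0).

Definition zpow (d : int) : graded := indeg ((zvar (ord0 : 'I_1) : zfield 1) ^ d).

Record subalgebra (S : graded -> Prop) : Prop := Subalgebra {
  subalg_V : forall f, S f -> V f;
  subalg_one : S gone;
  subalg_add : forall f g, S f -> S g -> S (gadd f g);
  subalg_scale : forall c f, Rq c -> S f -> S (gscale c f);
  subalg_mul : forall f g, S f -> S g -> S (gmul f g)
}.

Definition A (f : graded) : Prop :=
  forall S, subalgebra S -> (forall d, S (zpow d)) -> S f.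

(* A_k = A `&` V_k, with V_k seen inside V through [indeg] *)
Definition Ak k (P : zfield k) : Prop := symLaurent P /\ A (indeg P).

(* The ideal (g1, g2) of Rq[z_1^{+-1}, ..., z_k^{+-1}] *)
Definition in_ideal2 k (g1 g2 P : zfield k) : Prop :=
  exists a b : zfield k, [/\ laurentR a, laurentR b & P = a * g1 + b * g2].

End ShuffleAlgebra.

Arguments q1 {R}.
Arguments q2 {R}.
Arguments q {R}.

(* Main.v *)
From HB Require Import structures.
Require Import Defs.
From mathcomp Require Import all_boot all_order all_fingroup all_algebra ring.
From mathcomp Require Import complex mpoly reals.
Local Open Scope ring_scope.

Set Implicit Arguments.
Unset Strict Implicit.
Unset Printing Implicit Defensive.

Import GRing.Theory Num.Theory.

(** Let I_(a,b) be the ideal of Laurent polynomials generated by the two given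
elements written in the variables z_a, z_b instead of z_1, z_2.  The theorem is
the case (a, b) = (1, 2) of a statement that is stable under the shuffle
product: a symmetric Laurent polynomial P lies in I_(a,b) for ALL a <> b
([in_pair_ideals]).  In degrees 0 and 1 there are no such pairs, so the
generators z_1^d satisfy it, and the families of such P form a subalgebra of V
([admissible_family_subalgebra]) that contains A.

Stability under the product.  Fix a <> b, let t exchange z_a and z_b, and let O
be the ring obtained from the Laurent polynomials by inverting all z_i - z_j
except z_a - z_b.  Twice the symmetrization of X is the sum over all
permutations s of Y + t(Y), Y = s(X), so it is enough to show that each
Y + t(Y) lies in I_(a,b) O ([placed_swap]).  In Y the variables of P are placed
at some positions and those of Q at the others.
- If z_a and z_b are both variables of P (or both of Q), then Y has no pole along
  z_a = z_b, and its factor P(...) is in I_(a,b) by hypothesis on P.  As t fixes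
  both generators, Y + t(Y) is in I_(a,b) O as well.
- Otherwise Y = f * omega(z_a, z_b), or f * omega(z_b, z_a), with f in O.
  Divided differences along z_a - z_b preserve O, so f = f1 + z_a f2 with f1, f2
  in O fixed by t ([swap_decomp]); hence Y + t(Y) is an O-combination of
  omega(z_a, z_b) + omega(z_b, z_a) and
  z_a omega(z_a, z_b) + z_b omega(z_b, z_a).  The first is the first generator,
  and twice the second is
  (z_a + z_b) (first generator) + z_a z_b (second generator)
  ([kernel_swap_rel]).

Removing the denominators.  Both steps set one variable equal to another.  An
element of the intersection of the rings O over all pairs is a Laurent
polynomial: if (z_c - z_d) x is Laurent and x has no pole along z_c = z_d, the
numerator of (z_c - z_d) x vanishes at z_d := z_c, hence is divisible by
z_c - z_d ([loc_laurent]).  If (z_c - z_d) x = u g1 + v g2, where g1, g2 do not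
involve z_d, then 0 = u' g1 + v' g2 with u', v' the specializations of u, v at
z_d := z_c, and dividing u - u' and v - v' by z_c - z_d shows that x is in the
ideal ([ideal2_cancel]).  Since {c, d} <> {a, b}, one of z_c, z_d is not among
z_a, z_b, so this applies to every denominator allowed in O. *)

(** * Subrings and polynomials with coefficients in a subring *)

(** Subrings are Prop-valued, as [laurent] and [Rq] are: membership in the rings
of Laurent polynomials and in their localizations is an existence statement. *)
Record is_subring (K : nzRingType) (B : K -> Prop) : Prop := IsSubring {
  subring1 : B 1;
  subringB : forall x y, B x -> B y -> B (x - y);
  subringM : forall x y, B x -> B y -> B (x * y)
}.

Section Subring.
Variables (K : nzRingType) (B : K -> Prop) (hB : is_subring B).

Lemma subring0 : B 0.
Proof. by rewrite -(subrr 1); apply: subringB => //; apply: subring1. Qed.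

Lemma subringN x : B x -> B (- x).
Proof. by move=> Bx; rewrite -sub0r; apply: subringB => //; apply: subring0. Qed.

Lemma subringD x y : B x -> B y -> B (x + y).
Proof.
move=> Bx By; rewrite -[y]opprK.
by apply: subringB => //; apply: subringN.
Qed.

Lemma subring_sum I r (P : pred I) (F : I -> K) :
  (forall i, P i -> B (F i)) -> B (\sum_(i <- r | P i) F i).
Proof. by move=> BF; apply: big_ind => //; [apply: subring0 | apply: subringD]. Qed.

Lemma subring_prod I r (P : pred I) (F : I -> K) :
  (forall i, P i -> B (F i)) -> B (\prod_(i <- r | P i) F i).
Proof. by move=> BF; apply: big_ind => //; [apply: subring1 | apply: subringM]. Qed.

Lemma subringX x m : B x -> B (x ^+ m).
Proof.
move=> Bx; elim: m => [|m IHm]; first exact: subring1.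
by rewrite exprS; apply: subringM.
Qed.

Lemma subring_nat m : B m%:R.
Proof.
elim: m => [|m IHm]; first exact: subring0.
by rewrite mulrS; apply: subringD => //; apply: subring1.
Qed.

End Subring.

Definition coefs_in (F : fieldType) (S : F -> Prop) n (p : {mpoly F[n]}) :=
  forall m, S p@_m.

Section Polynomials.
Variables (F : fieldType) (n : nat).

Lemma mpoly_subring_ind (S : F -> Prop) (T : {mpoly F[n]} -> Prop) :
    is_subring T -> (forall c, S c -> T c%:MP) -> (forall i, T 'X_i) ->
  forall p, coefs_in S p -> T p.
Proof.
move=> hT TC TX p Sp; rewrite (mpolyE p); apply: subring_sum => // m _.
rewrite -mul_mpolyC mpolyXE_id; apply: subringM => //; first exact: TC.
by apply: subring_prod => // i _; apply: subringX.
Qed.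

Lemma mpoly_morph_eq (K : nzRingType) (f g : {rmorphism {mpoly F[n]} -> K}) :
    (forall c, f c%:MP = g c%:MP) -> (forall i, f 'X_i = g 'X_i) -> f =1 g.
Proof.
move=> fgC fgX p.
apply: (@mpoly_subring_ind (fun=> True) (fun p => f p = g p)) => //.
split=> [|x y fx fy|x y fx fy]; first by rewrite !rmorph1.
  by rewrite !rmorphB fx fy.
by rewrite !rmorphM fx fy.
Qed.

Section Coefficients.
Variables (S : F -> Prop) (hS : is_subring S).

Lemma coefs_in_const c : S c -> coefs_in S (c%:MP : {mpoly F[n]}).
Proof.
move=> Sc m; rewrite mcoeffC.
by apply: subringM => //; apply: subring_nat.
Qed.

Lemma coefs_in_monomial m : coefs_in S ('X_[m] : {mpoly F[n]}).
Proof. by move=> m'; rewrite mcoeffX; apply: subring_nat. Qed.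

Lemma coefs_in_subring : is_subring (@coefs_in F S n).
Proof.
split=> [|p q Sp Sq m|p q Sp Sq m].
- by rewrite -mpolyC1; apply: coefs_in_const; apply: subring1.
- by rewrite mcoeffB; apply: subringB.
- by rewrite mcoeffM; apply: subring_sum => // k _; apply: subringM.
Qed.

End Coefficients.

Definition collapse_ord (c d i : 'I_n) := if i == d then c else i.

(** The specialization z_d := z_c.  It is used on numerators only: on rational
functions it has no meaning along the poles z_c = z_d. *)
Definition collapse c d : {mpoly F[n]} -> {mpoly F[n]} :=
  mmap (@mpolyC n F) (fun i => 'X_(collapse_ord c d i)).

HB.instance Definition _ c d := GRing.RMorphism.on (collapse c d).

Lemma collapseC c d a : collapse c d a%:MP = a%:MP.
Proof. exact: mmapC. Qed.

Lemma collapseX c d i : collapse c d 'X_i = 'X_(collapse_ord c d i).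
Proof. by rewrite /collapse mmapX mmap1U. Qed.

Lemma mpolyX_diff_neq0 (i j : 'I_n) : i != j -> ('X_i : {mpoly F[n]}) - 'X_j != 0.
Proof.
apply: contra; rewrite subr_eq0 => /eqP /(congr1 (mcoeff U_(i))).
rewrite !mcoeffXU eqxx /= => /eqP.
by case: (j =P i) => [->//|_]; rewrite oner_eq0.
Qed.

(** Divisibility by X_c - X_d, with control of the coefficients.  The polynomials
with this property form a subring, by the Leibniz rule
xy - x'y' = (x - x') y + x' (y - y'), so it is enough to look at the constants and
the variables. *)
Lemma collapse_diff S c d p : is_subring S -> coefs_in S p ->
  exists2 p', coefs_in S p' & p - collapse c d p = ('X_c - 'X_d) * p'.
Proof.
move=> hS; have hP := coefs_in_subring hS.
(* The Leibniz rule needs the coefficients of the image of p too, which are in S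
when those of p and of p' are. *)
pose T p := exists p', [/\ coefs_in S p, coefs_in S p'
  & p - collapse c d p = ('X_c - 'X_d) * p'].
move=> Sp; suff: T p by case=> p' [_ ? ?]; exists p'.
move: p Sp; apply: (mpoly_subring_ind (T := T)).
- split.
  + exists 0; split; [exact: (subring1 hP)|exact: (subring0 hP)|].
    by rewrite rmorph1 subrr mulr0.
  + move=> x y [x' [Sx Sx' ex]] [y' [Sy Sy' ey]].
    exists (x' - y'); split; [exact: (subringB hP)|exact: (subringB hP)|].
    by rewrite rmorphB /= mulrBr -ex -ey; ring.
  + move=> x y [x' [Sx Sx' ex]] [y' [Sy Sy' ey]].
    exists (x' * y + (x - ('X_c - 'X_d) * x') * y').
    split; first exact: (subringM hP).
      apply: (subringD hP) => //; first exact: (subringM hP).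
      apply: (subringM hP) => //; apply: (subringB hP) => //.
      apply: (subringM hP) => //.
      by apply: (subringB hP) => //; apply: coefs_in_monomial.
    rewrite rmorphM /=.
    have -> : collapse c d x = x - ('X_c - 'X_d) * x' by rewrite -ex; ring.
    have -> : collapse c d y = y - ('X_c - 'X_d) * y' by rewrite -ey; ring.
    by ring.
- move=> a Sa; exists 0; split; [exact: coefs_in_const|exact: (subring0 hP)|].
  by rewrite collapseC subrr mulr0.
- move=> i; rewrite /T collapseX /collapse_ord; have [->|_] := eqVneq i d.
    (* X_d is sent to X_c, and X_d - X_c = (X_c - X_d) (-1). *)
    exists (-1); split; [exact: coefs_in_monomial| |by ring].
    by apply: (subringN hP); apply: (subring1 hP).
  exists 0; split; [exact: coefs_in_monomial|exact: (subring0 hP)|].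
  by rewrite subrr mulr0.
Qed.

End Polynomials.

(** * Renaming the variables of a rational function *)

(** [rsubst] is computed on the representative of a fraction; this identity links
the representative to the fraction itself. *)
Lemma ratfun_numden (F : fieldType) n (x : ratfun F n) :
  x = FracField.tofrac \n_(generic_quotient.repr x)
    / FracField.tofrac \d_(generic_quotient.repr x).
Proof.
rewrite -[LHS]generic_quotient.reprK; move: (generic_quotient.repr x) => r.
unlock FracField.tofrac.
rewrite -[X in _ = _ * X]FracField.pi_inv -[RHS]FracField.pi_mul.
rewrite /FracField.mulf /FracField.invf /= !numden_Ratio ?oner_eq0 ?denom_ratioP //.
by rewrite mulr1 mul1r Ratio_numden.
Qed.

Lemma ratfun_ind (F : fieldType) n (T : ratfun F n -> Prop) :
    (forall p q, q != 0 -> T (FracField.tofrac p / FracField.tofrac q)) ->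
  forall x, T x.
Proof. by move=> Tpq x; rewrite (ratfun_numden x); apply/Tpq/denom_ratioP. Qed.

Section Renaming.
Variables (F : fieldType) (m n : nat) (v : 'I_m -> 'I_n) (v_inj : injective v).

Definition mrename : {mpoly F[m]} -> {mpoly F[n]} :=
  mmap (@mpolyC n F) (fun i => 'X_(v i)).

HB.instance Definition _ := GRing.RMorphism.on mrename.

(** The left inverse sends X_(v i) to X_i and the other variables to 0. *)
Lemma mrename_inj : injective mrename.
Proof.
pose h (j : 'I_n) : {mpoly F[m]} :=
  if [pick i | v i == j] is Some i then 'X_i else 0.
apply: (can_inj (g := mmap (@mpolyC m F) h)) => p.
pose f := mmap (@mpolyC m F) h \o mrename.
apply: (@mpoly_morph_eq F m _ f idfun) => [c|i] /=.
  by rewrite /mrename !mmapC.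
rewrite /mrename mmapX mmap1U mmapX mmap1U /h.
by case: pickP => [j /eqP/v_inj->//|/(_ i)]; rewrite eqxx.
Qed.

Lemma mrename_neq0 p : p != 0 -> mrename p != 0.
Proof. by apply: contra => /eqP e; rewrite -(inj_eq mrename_inj) e rmorph0. Qed.

Lemma mmap_zvar p :
  mmap (@rconst F n) (fun i => zvar (v i)) p = FracField.tofrac (mrename p).
Proof.
pose f := mmap (@rconst F n) (fun i => zvar (v i)).
pose g := @FracField.tofrac {mpoly F[n]} \o mrename.
apply: (@mpoly_morph_eq F m (ratfun F n) f g) => [c|i] /=; rewrite /f /g /=.
  by rewrite /mrename !mmapC.
by rewrite /mrename !mmapX !mmap1U.
Qed.

(** For injective [v] the values of [rsubst] do not depend on the representative,
so that it is a field morphism.  The proof of injectivity is an argument, so that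
this morphism structure can be attached to the function. *)
Definition rename of injective v : ratfun F m -> ratfun F n :=
  rsubst (fun i => zvar (v i)).

(** An injective renaming does not kill the denominators, so two fractions that
are equal by cross-multiplication remain so after it. *)
Lemma rename_frac p q : q != 0 ->
  rename v_inj (FracField.tofrac p / FracField.tofrac q)
  = FracField.tofrac (mrename p) / FracField.tofrac (mrename q).
Proof.
move=> nz_q; rewrite /rename /rsubst !mmap_zvar.
have := ratfun_numden (FracField.tofrac p / FracField.tofrac q).
set r := generic_quotient.repr _ => e.
have nz_d := denom_ratioP r; apply/eqP.
rewrite eqr_div ?tofrac_eq0 ?mrename_neq0 //.
rewrite -!tofracM tofrac_eq -!rmorphM (inj_eq mrename_inj) -tofrac_eq !tofracM.
by rewrite -eqr_div ?tofrac_eq0 // -e.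
Qed.

Lemma tofrac_rename p :
  rename v_inj (FracField.tofrac p) = FracField.tofrac (mrename p).
Proof.
have := rename_frac p (oner_neq0 _).
by rewrite !rmorph1 !divr1.
Qed.

Lemma rename_is_zmod_morphism : zmod_morphism (rename v_inj).
Proof.
apply: ratfun_ind => p q nz_q; apply: ratfun_ind => p' q' nz_q'.
rewrite -mulNr addf_div ?tofrac_eq0 // -tofracN -!tofracM -tofracD.
rewrite !rename_frac ?mulf_neq0 // rmorphD !rmorphM rmorphN /=.
rewrite tofracD !tofracM tofracN -addf_div ?tofrac_eq0 ?mrename_neq0 //.
by rewrite mulNr.
Qed.

Lemma rename_is_monoid_morphism : monoid_morphism (rename v_inj).
Proof.
split; first by rewrite -[1]tofrac1 tofrac_rename rmorph1.
apply: ratfun_ind => p q nz_q; apply: ratfun_ind => p' q' nz_q'.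
rewrite mulf_div -!tofracM !rename_frac ?mulf_neq0 //.
by rewrite !rmorphM /= mulf_div.
Qed.

HB.instance Definition _ := GRing.isZmodMorphism.Build (ratfun F m) (ratfun F n)
  (rename v_inj) rename_is_zmod_morphism.
HB.instance Definition _ := GRing.isMonoidMorphism.Build (ratfun F m) (ratfun F n)
  (rename v_inj) rename_is_monoid_morphism.

Lemma rename_const c : rename v_inj (rconst m c) = rconst n c.
Proof. by rewrite tofrac_rename /mrename mmapC. Qed.

Lemma rename_zvar i : rename v_inj (zvar i) = zvar (v i).
Proof. by rewrite tofrac_rename /mrename mmapX mmap1U. Qed.

End Renaming.

Lemma ratfun_morph_eq (F K : fieldType) n (f g : {rmorphism ratfun F n -> K}) :
    (forall c, f (rconst n c) = g (rconst n c)) ->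
    (forall i, f (zvar i) = g (zvar i)) -> f =1 g.
Proof.
move=> fgC fgX; apply: ratfun_ind => p q _; rewrite !fmorph_div.
have e := @mpoly_morph_eq F n K (f \o @FracField.tofrac _)
           (g \o @FracField.tofrac _) fgC fgX.
by have /= -> := e p; have /= -> := e q.
Qed.

Lemma rename_comp (F : fieldType) m n r (v : 'I_m -> 'I_n) (w : 'I_n -> 'I_r)
    (hv : injective v) (hw : injective w) (u : 'I_m -> 'I_r) (hu : injective u) :
    w \o v =1 u ->
  forall x : ratfun F m, rename hw (rename hv x) = rename hu x.
Proof.
move=> e; apply: (@ratfun_morph_eq F _ m (rename hw \o rename hv) (rename hu)).
  by move=> c /=; rewrite !rename_const.
by move=> i /=; rewrite !rename_zvar -e.
Qed.

(** * Laurent polynomials and their localizations *)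

Section Laurent.
Variables (F : fieldType) (S : F -> Prop) (hS : is_subring S).
Local Notation tofrac := (@FracField.tofrac _).

Section Fixed.
Variable n : nat.
Local Notation L := (@laurent F S n).

Lemma zvar_diff_neq0 (i j : 'I_n) : i != j -> zvar i - zvar j != 0 :> ratfun F n.
Proof. by move=> ij; rewrite -tofracB tofrac_eq0 mpolyX_diff_neq0. Qed.

Lemma monomial_neq0 m : 'X_[m] != 0 :> {mpoly F[n]}.
Proof. by rewrite -msupp_eq0 msuppX. Qed.

Lemma laurent_poly p : coefs_in S p -> L (tofrac p).
Proof. by exists p, 0%MM; rewrite mpolyX0 tofrac1 divr1. Qed.

Lemma laurent_const c : S c -> L (rconst n c).
Proof. by move=> Sc; apply: laurent_poly; apply: coefs_in_const. Qed.

Lemma laurent_zvar (i : 'I_n) : L (zvar i).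
Proof. by apply: laurent_poly; apply: coefs_in_monomial. Qed.

Lemma laurent_zvarV (i : 'I_n) : L (zvar i)^-1.
Proof.
exists 1, U_(i)%MM; split; last by rewrite tofrac1 mul1r.
exact: subring1 (coefs_in_subring n hS).
Qed.

Lemma laurent_common x y : L x -> L y -> exists p p' m,
  [/\ coefs_in S p, coefs_in S p', x = tofrac p / tofrac 'X_[m]
    & y = tofrac p' / tofrac 'X_[m]].
Proof.
have hP := coefs_in_subring n hS.
move=> [p [m [Sp ->]]] [p' [m' [Sp' ->]]].
exists (p * 'X_[m']), (p' * 'X_[m]), (m + m')%MM; split.
- by apply: (subringM hP) => //; apply: coefs_in_monomial.
- by apply: (subringM hP) => //; apply: coefs_in_monomial.
- by rewrite mpolyXD !tofracM -mulf_div divff ?mulr1 // tofrac_eq0 monomial_neq0.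
rewrite addmC mpolyXD !tofracM -mulf_div divff ?mulr1 //.
by rewrite tofrac_eq0 monomial_neq0.
Qed.

Lemma laurent_subring : is_subring L.
Proof.
have hP := coefs_in_subring n hS.
split.
- by rewrite -tofrac1; apply: laurent_poly; apply: subring1 hP.
- move=> x y Lx Ly; have [p [p' [m [Sp Sp' -> ->]]]] := laurent_common Lx Ly.
  by exists (p - p'), m; rewrite -mulrBl tofracB; split=> //; apply: (subringB hP).
move=> x y [p [m [Sp ->]]] [p' [m' [Sp' ->]]].
exists (p * p'), (m + m')%MM; rewrite mpolyXD !tofracM mulf_div; split=> //.
exact: (subringM hP).
Qed.

Lemma laurent_ind (T : ratfun F n -> Prop) :
    is_subring T -> (forall c, S c -> T (rconst n c)) ->
    (forall i, T (zvar i)) -> (forall i, T (zvar i)^-1) ->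
  forall x, L x -> T x.
Proof.
move=> hT TC TX TV x [p [m [Sp ->]]]; apply: (subringM hT).
  apply: (@mpoly_subring_ind F n S (fun p => T (tofrac p))) => //.
  split=> [|y z|y z]; first by rewrite tofrac1; apply: subring1 hT.
    by rewrite tofracB; apply: (subringB hT).
  by rewrite tofracM; apply: (subringM hT).
rewrite mpolyXE_id rmorph_prod -prodfV; apply: (subring_prod hT) => i _.
by rewrite rmorphXn -exprVn; apply: (subringX hT); apply: TV.
Qed.

End Fixed.

Lemma rename_laurent m n (v : 'I_m -> 'I_n) (v_inj : injective v) x :
  laurent S x -> laurent S (rename v_inj x).
Proof.
have hL := laurent_subring n.
apply: (@laurent_ind m (fun x => laurent S (rename v_inj x))).
- split=> [|y z Ly Lz|y z Ly Lz]; rewrite ?rmorph1 ?rmorphB ?rmorphM.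
  + exact: subring1 hL.
  + exact: (subringB hL).
  + exact: (subringM hL).
- by move=> c Sc; rewrite rename_const; apply: laurent_const.
- by move=> i; rewrite rename_zvar; apply: laurent_zvar.
- by move=> i; rewrite fmorphV /= rename_zvar; apply: laurent_zvarV.
Qed.

(** The denominators inverted in a localization, kept as explicit products so that
their factors can be cancelled one at a time. *)
Inductive diffprod n (G : rel 'I_n) : ratfun F n -> Prop :=
| diffprod1 : diffprod G 1
| diffprod_cons i j w : G i j -> diffprod G w ->
    diffprod G ((zvar i - zvar j) * w).

Definition loc n (G : rel 'I_n) (x : ratfun F n) : Prop :=
  exists2 w, diffprod G w & laurent S (w * x).

Definition distinct n : rel 'I_n := fun i j => i != j.

Definition off_pair n (a b : 'I_n) : rel 'I_n :=
  fun i j => [&& i != j, (i, j) != (a, b) & (i, j) != (b, a)].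

Lemma diffprodM n (G : rel 'I_n) w w' :
  diffprod G w -> diffprod G w' -> diffprod G (w * w').
Proof.
move=> Gw Gw'; elim: Gw => [|i j u Gij _ IH]; first by rewrite mul1r.
by rewrite -mulrA; apply: diffprod_cons.
Qed.

Lemma diffprod_laurent n (G : rel 'I_n) w : diffprod G w -> laurent S w.
Proof.
have hL := laurent_subring n.
elim=> [|i j u Gij _ IH]; first exact: subring1 hL.
by apply: (subringM hL) => //; apply: (subringB hL); apply: laurent_zvar.
Qed.

Lemma rename_diffprod m n (v : 'I_m -> 'I_n) (v_inj : injective v)
    (G : rel 'I_m) (G' : rel 'I_n) w :
    (forall i j, G i j -> G' (v i) (v j)) ->
  diffprod G w -> diffprod G' (rename v_inj w).
Proof.
move=> GG'; elim=> [|i j u Gij _ IH]; first by rewrite rmorph1; apply: diffprod1.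
by rewrite rmorphM rmorphB /= !rename_zvar; apply: diffprod_cons; auto.
Qed.

Lemma rename_loc m n (v : 'I_m -> 'I_n) (v_inj : injective v)
    (G : rel 'I_m) (G' : rel 'I_n) x :
    (forall i j, G i j -> G' (v i) (v j)) ->
  loc G x -> loc G' (rename v_inj x).
Proof.
move=> GG' [w Gw Lwx]; exists (rename v_inj w).
  exact: rename_diffprod Gw.
by rewrite -rmorphM; apply: rename_laurent.
Qed.

Section Localization.
Variables (n : nat) (G : rel 'I_n).
Hypothesis G_neq : forall i j, G i j -> i != j.

Lemma diffprod_neq0 w : diffprod G w -> w != 0.
Proof.
elim=> [|i j u Gij _ IH]; first exact: oner_neq0.
by apply: mulf_neq0 IH; apply/zvar_diff_neq0/G_neq.
Qed.

Lemma laurent_loc x : laurent S x -> loc G x.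
Proof. by exists 1; [apply: diffprod1 | rewrite mul1r]. Qed.

Lemma loc_subring : is_subring (loc G).
Proof.
have hL := laurent_subring n.
split; first by apply/laurent_loc/(subring1 hL).
  move=> x y [w Gw Lwx] [w' Gw' Lwy]; exists (w * w'); first exact: diffprodM.
  have -> : w * w' * (x - y) = w' * (w * x) - w * (w' * y) by ring.
  apply: (subringB hL); apply: (subringM hL) => //.
    exact: diffprod_laurent Gw'.
  exact: diffprod_laurent Gw.
move=> x y [w Gw Lwx] [w' Gw' Lwy]; exists (w * w'); first exact: diffprodM.
by rewrite mulrACA; apply: (subringM hL).
Qed.

Lemma loc_inv i j : G i j -> loc G (zvar i - zvar j)^-1.
Proof.
move=> Gij; exists (zvar i - zvar j).
  rewrite -[X in diffprod _ X]mulr1.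
  by apply: diffprod_cons => //; apply: diffprod1.
rewrite divff ?zvar_diff_neq0 ?G_neq //.
exact: subring1 (laurent_subring n).
Qed.

(** As a ring, the localization is generated by the Laurent polynomials and the
inverses of the allowed differences. *)
Lemma loc_ind (T : ratfun F n -> Prop) : is_subring T ->
    (forall x, laurent S x -> T x) ->
    (forall i j, G i j -> T (zvar i - zvar j)^-1) ->
  forall x, loc G x -> T x.
Proof.
move=> hT TL TG x [w Gw Lwx].
have -> : x = w^-1 * (w * x) by rewrite mulKf // diffprod_neq0.
apply: (subringM hT); last exact: TL.
elim: Gw => [|i j u Gij _ IH]; first by rewrite invr1; apply: subring1 hT.
by rewrite invfM; apply: (subringM hT) => //; apply: TG.
Qed.

End Localization.

Lemma off_pair_neq n (a b i j : 'I_n) : off_pair a b i j -> i != j.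
Proof. by case/and3P. Qed.

(** The specialization z_d := z_c identifies no two variables other than z_c and
z_d, hence kills none of the other differences. *)
Lemma collapse_diffprod n (c d : 'I_n) w : diffprod (off_pair c d) w ->
  exists2 W, w = tofrac W & collapse c d W != 0.
Proof.
elim=> [|i j u Gij _ [W -> nzW]].
  by exists 1; rewrite ?tofrac1 // rmorph1 oner_neq0.
exists (('X_i - 'X_j) * W); first by rewrite tofracM tofracB.
rewrite rmorphM rmorphB /= !collapseX.
apply: mulf_neq0 nzW; apply: mpolyX_diff_neq0.
move: Gij; rewrite /off_pair /collapse_ord !xpair_eqE => /and3P[ij].
case: (i =P d) ij => [->|_]; case: (j =P d) => [->|_]; rewrite ?eqxx //= ?andbT.
- by move=> _ _; rewrite eq_sym.
- by [].
Qed.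

(** Clear denominators and set z_d := z_c.  A denominator prime to z_c - z_d does
not vanish there, so the numerator p of (z_c - z_d) x does; hence z_c - z_d
divides p. *)
Lemma loc_laurent n (c d : 'I_n) x : c != d -> loc (off_pair c d) x ->
  laurent S ((zvar c - zvar d) * x) -> laurent S x.
Proof.
move=> cd [w Gw Lwx] Ldx; have [W eW nzW] := collapse_diffprod Gw.
have [p [p' [m [Sp Sp' ep ep']]]] := laurent_common Ldx Lwx.
have nzX : tofrac 'X_[m] != 0 :> ratfun F n by rewrite tofrac_eq0 monomial_neq0.
have e : W * p = ('X_c - 'X_d) * p'.
  apply/eqP; rewrite -tofrac_eq !tofracM tofracB -eW.
  have -> : tofrac p = (zvar c - zvar d) * x * tofrac 'X_[m] by rewrite ep divfK.
  have -> : tofrac p' = w * x * tofrac 'X_[m] by rewrite ep' divfK.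
  by rewrite /zvar; apply/eqP; ring.
have p0 : collapse c d p = 0.
  move/(congr1 (collapse c d))/eqP: e.
  rewrite !rmorphM rmorphB /= !collapseX /collapse_ord eqxx (negbTE cd).
  by rewrite subrr mul0r mulf_eq0 (negbTE nzW) => /eqP.
have [p1 Sp1] := collapse_diff c d hS Sp.
rewrite p0 subr0 => ep1; exists p1, m; split=> //.
apply: (mulfI (zvar_diff_neq0 cd)).
by rewrite ep ep1 tofracM tofracB mulrA.
Qed.

(** The allowed differences are removed one at a time: each is a factor of the
denominator along which, by hypothesis, there is no pole. *)
Lemma laurent_of_loc n (x : ratfun F n) : loc (@distinct n) x ->
    (forall a b, a != b -> loc (off_pair a b) x) ->
  laurent S x.
Proof.
move=> [w Gw Lwx] locx; have hL := laurent_subring n.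
elim: Gw Lwx => [|c d u cd Gu IH]; first by rewrite mul1r.
move=> Lwx; apply: IH; apply: (@loc_laurent _ c d) => //; last by rewrite mulrA.
apply: (subringM (loc_subring _)); last exact: locx.
by apply: laurent_loc; apply: diffprod_laurent Gu.
Qed.

End Laurent.

(** * Two-generator ideals and divided differences *)

Definition ideal2 (K : nzRingType) (B : K -> Prop) (g1 g2 x : K) : Prop :=
  exists a b, [/\ B a, B b & x = a * g1 + b * g2].

Section Ideal2.
Variables (K : comNzRingType) (B : K -> Prop) (hB : is_subring B) (g1 g2 : K).

Lemma ideal2_0 : ideal2 B g1 g2 0.
Proof. by exists 0, 0; rewrite !mul0r addr0; split=> //; apply: (subring0 hB). Qed.

Lemma ideal2D x y :
  ideal2 B g1 g2 x -> ideal2 B g1 g2 y -> ideal2 B g1 g2 (x + y).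
Proof.
move=> [a [b [Ba Bb ->]]] [a' [b' [Ba' Bb' ->]]].
by exists (a + a'), (b + b'); split; [exact: (subringD hB)|exact: (subringD hB)|ring].
Qed.

Lemma ideal2Ml c x : B c -> ideal2 B g1 g2 x -> ideal2 B g1 g2 (c * x).
Proof.
move=> Bc [a [b [Ba Bb ->]]].
by exists (c * a), (c * b); split; [exact: (subringM hB)|exact: (subringM hB)|ring].
Qed.

Lemma ideal2_sum I r (P : pred I) (E : I -> K) :
  (forall i, P i -> ideal2 B g1 g2 (E i)) ->
  ideal2 B g1 g2 (\sum_(i <- r | P i) E i).
Proof. by move=> BE; apply: big_ind => //; [apply: ideal2_0|apply: ideal2D]. Qed.

Lemma ideal2_sub x : B g1 -> B g2 -> ideal2 B g1 g2 x -> B x.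
Proof.
move=> B1 B2 [a [b [Ba Bb ->]]].
by apply: (subringD hB); apply: (subringM hB).
Qed.

End Ideal2.

Lemma ideal2_morph (K K' : nzRingType) (f : {rmorphism K -> K'})
    (B : K -> Prop) (B' : K' -> Prop) g1 g2 x :
    (forall y, B y -> B' (f y)) ->
  ideal2 B g1 g2 x -> ideal2 B' (f g1) (f g2) (f x).
Proof.
move=> BB' [a [b [Ba Bb ->]]].
by exists (f a), (f b); split; [exact: BB'|exact: BB'|rewrite rmorphD !rmorphM].
Qed.

Section Poles.
Variables (F : fieldType) (S : F -> Prop) (hS : is_subring S) (n : nat).
Variables (a b : 'I_n).
Local Notation tofrac := (@FracField.tofrac _).
Local Notation L := (@laurent F S n).
Local Notation O := (loc S (off_pair a b)).
Let hL : is_subring L := laurent_subring hS n.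
Let hO : is_subring O := loc_subring hS (off_pair a b).

(** Polynomials that do not involve variables other than z_a, z_b, expressed by
what is needed of them: specializing a third variable does not change them. *)
Definition collapse_stable (g : ratfun F n) : Prop :=
  exists p, [/\ coefs_in S p, g = tofrac p
    & forall c d, d != a -> d != b -> collapse c d p = p].

Lemma collapse_stable_subring : is_subring collapse_stable.
Proof.
have hP := coefs_in_subring n hS; split.
- exists 1; split; [exact: subring1 hP|by rewrite tofrac1|by move=> *; rewrite rmorph1].
- move=> x y [p [Sp -> ep]] [p' [Sp' -> ep']]; exists (p - p').
  split; [exact: (subringB hP)|by rewrite tofracB|].
  by move=> c d da db; rewrite rmorphB /= ep ?ep'.
move=> x y [p [Sp -> ep]] [p' [Sp' -> ep']]; exists (p * p').
split; [exact: (subringM hP)|by rewrite tofracM|].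
by move=> c d da db; rewrite rmorphM /= ep ?ep'.
Qed.

Lemma collapse_stable_const c : S c -> collapse_stable (rconst n c).
Proof.
move=> Sc; exists c%:MP; split=> //; first exact: coefs_in_const.
by move=> *; rewrite collapseC.
Qed.

Lemma collapse_stable_zvar i : (i == a) || (i == b) -> collapse_stable (zvar i).
Proof.
move=> iab; exists 'X_i; split=> //; first exact: coefs_in_monomial.
move=> c d da db; rewrite collapseX /collapse_ord; case: (i =P d) iab => // ->.
by rewrite (negbTE da) (negbTE db).
Qed.

Variables g1 g2 : ratfun F n.
Hypotheses (stable1 : collapse_stable g1) (stable2 : collapse_stable g2).

(** A difference z_c - z_d in which z_d does not occur in the generators is a
nonzerodivisor modulo the ideal.  Write (z_c - z_d) x = u g1 + v g2.  Setting
z_d := z_c gives 0 = u' g1 + v' g2; subtract, and divide u - u' and v - v' by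
z_c - z_d. *)
Lemma ideal2_cancel c d x : c != d -> d != a -> d != b -> L x ->
  ideal2 L g1 g2 ((zvar c - zvar d) * x) -> ideal2 L g1 g2 x.
Proof.
move=> cd da db Lx [u [v [Lu Lv ex]]].
have [pu [pv [m [Su Sv eu ev]]]] := laurent_common hS Lu Lv.
have [px [m' [Sx ex']]] := Lx.
have nzX m1 : tofrac 'X_[m1] != 0 :> ratfun F n.
  by rewrite tofrac_eq0 monomial_neq0.
have hP := coefs_in_subring n hS.
have [G1 [SG1 e1 st1]] := stable1; have [G2 [SG2 e2 st2]] := stable2.
have e : ('X_c - 'X_d) * px * 'X_[m] = 'X_[m'] * pu * G1 + 'X_[m'] * pv * G2.
  apply/eqP; rewrite -tofrac_eq tofracD !tofracM tofracB -e1 -e2.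
  have -> : tofrac px = x * tofrac 'X_[m'] by rewrite ex' divfK.
  have -> : tofrac pu = u * tofrac 'X_[m] by rewrite eu divfK.
  have -> : tofrac pv = v * tofrac 'X_[m] by rewrite ev divfK.
  rewrite [eqbLHS](_ : _ = (zvar c - zvar d) * x
                           * tofrac 'X_[m'] * tofrac 'X_[m]); last first.
    by rewrite /zvar; ring.
  by rewrite ex; apply/eqP; ring.
have SX m1 (p : {mpoly F[n]}) : coefs_in S p -> coefs_in S ('X_[m1] * p).
  by move=> Sp; apply: (subringM hP) => //; apply: coefs_in_monomial.
have [pu' Su' eu'] := collapse_diff c d hS (SX m' _ Su).
have [pv' Sv' ev'] := collapse_diff c d hS (SX m' _ Sv).
(* The specialization of e: its left-hand side has the factor X_c - X_d. *)
have e0 : collapse c d ('X_[m'] * pu) * G1 + collapse c d ('X_[m'] * pv) * G2 = 0.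
  move/(congr1 (collapse c d)): e; rewrite rmorphD !(rmorphM (collapse c d)) /=.
  rewrite rmorphB /= !collapseX /collapse_ord eqxx (negbTE cd) subrr !mul0r.
  by rewrite st1 // st2.
have e3 : px * 'X_[m] = pu' * G1 + pv' * G2.
  apply: (mulfI (mpolyX_diff_neq0 F cd)).
  rewrite mulrA e mulrDr !mulrA -eu' -ev' !mulrBl addrACA -opprD e0.
  by rewrite subr0.
exists (tofrac pu' / tofrac 'X_[m' + m]), (tofrac pv' / tofrac 'X_[m' + m]).
split; [by exists pu', (m' + m)%MM|by exists pv', (m' + m)%MM|].
rewrite e1 e2 mulrAC [X in _ + X]mulrAC -mulrDl -!tofracM -tofracD -e3 ex'.
by rewrite tofracM mpolyXD tofracM -mulf_div divff ?mulr1.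
Qed.

(** The ideal is saturated with respect to the differences other than z_a - z_b:
one of the two variables in such a difference is neither z_a nor z_b, so
[ideal2_cancel] applies, possibly after a change of sign. *)
Lemma loc_ideal2 x : L x -> ideal2 O g1 g2 x -> ideal2 L g1 g2 x.
Proof.
move=> Lx [u [v [[w Gw Lu] [w' Gw' Lv] ex]]].
have : ideal2 L g1 g2 (w * w' * x).
  exists (w' * (w * u)), (w * (w' * v)); split; last by rewrite ex; ring.
    by apply: (subringM hL) => //; apply: (diffprod_laurent hS Gw').
  by apply: (subringM hL) => //; apply: (diffprod_laurent hS Gw).
(* Induction on the number of factors of the common denominator w w'. *)
have Gww' := diffprodM Gw Gw'.
elim: Gww' => [|c d {w w' Gw Gw' Lu Lv ex}w /and3P[/= cd n1 n2] Gw IH].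
  by rewrite mul1r.
rewrite -mulrA => h; apply: IH.
have Lwx : L (w * x) by apply: (subringM hL) => //; apply: (diffprod_laurent hS Gw).
have [/andP[da db]|] := boolP ((d != a) && (d != b)).
  exact: ideal2_cancel h.
rewrite negb_and !negbK => dab; apply: (@ideal2_cancel d c) => //.
- by rewrite eq_sym.
- apply: contraNneq cd => ca; rewrite ca in n1 *.
  by case/orP: dab n1 => /eqP->; rewrite ?eqxx.
- apply: contraNneq cd => cb; rewrite cb in n2 *.
  by case/orP: dab n2 => /eqP->; rewrite ?eqxx.
have -> : (zvar d - zvar c) * (w * x) = - 1 * ((zvar c - zvar d) * (w * x)).
  by ring.
by apply: ideal2Ml => //; apply: (subringN hL); apply: subring1 hL.
Qed.

End Poles.

Lemma inv_diff_div (K : fieldType) (x y d : K) : x != 0 -> y != 0 ->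
  (x^-1 - y^-1) / d = - (x^-1 * y^-1 * ((x - y) / d)).
Proof.
move=> nz_x nz_y; rewrite mulrA -mulNr; congr (_ / d).
by field; rewrite nz_x nz_y.
Qed.

Section Swap.
Variables (F : fieldType) (S : F -> Prop) (hS : is_subring S) (n : nat).
Variables (a b : 'I_n).
Hypothesis ab : a != b.
Local Notation L := (@laurent F S n).
Local Notation O := (loc S (off_pair a b)).
Let hL : is_subring L := laurent_subring hS n.
Let hO : is_subring O := loc_subring hS (off_pair a b).

Definition swap : ratfun F n -> ratfun F n := rename (@perm_inj _ (tperm a b)).

HB.instance Definition _ := GRing.RMorphism.on swap.

Lemma swap_const c : swap (rconst n c) = rconst n c.
Proof. exact: rename_const. Qed.

Lemma swap_zvarL : swap (zvar a) = zvar b.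
Proof. by rewrite /swap rename_zvar tpermL. Qed.

Lemma swap_zvarR : swap (zvar b) = zvar a.
Proof. by rewrite /swap rename_zvar tpermR. Qed.

Lemma swapK : involutive swap.
Proof.
apply: (@ratfun_morph_eq F _ n (swap \o swap) idfun) => [c|i] /=.
  by rewrite !swap_const.
by rewrite /swap !rename_zvar tpermK.
Qed.

Lemma swap_off_pair i j :
  off_pair a b i j -> off_pair a b (tperm a b i) (tperm a b j).
Proof.
rewrite /off_pair !xpair_eqE (inj_eq (@perm_inj _ _)) => /and3P[-> n1 n2] /=.
rewrite !(canF_eq (tpermK a b)) tpermL tpermR.
by rewrite n1 n2.
Qed.

Lemma swap_loc x : O x -> O (swap x).
Proof. by move=> Ox; apply: rename_loc Ox => // i j; apply: swap_off_pair. Qed.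

(** By the Leibniz rule the elements of the ring whose divided difference is also
in it form a subring, and this subring is closed under the inverses that exist in
the ring.  So only the generators of the ring have to be checked. *)
Lemma swap_div_diff x : O x -> O ((x - swap x) / (zvar a - zvar b)).
Proof.
move=> Ox; suff [] : O x /\ O ((x - swap x) / (zvar a - zvar b)) by [].
have nz := zvar_diff_neq0 F ab.
have hT : is_subring (fun x => O x /\ O ((x - swap x) / (zvar a - zvar b))).
  split.
  - by rewrite rmorph1 subrr mul0r; split; [exact: subring1 hO|exact: subring0 hO].
  - move=> y z [Oy Oy'] [Oz Oz']; split; first exact: (subringB hO).
    rewrite rmorphB /=.
    have -> : (y - z - (swap y - swap z)) / (zvar a - zvar b)
        = (y - swap y) / (zvar a - zvar b) - (z - swap z) / (zvar a - zvar b).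
      by ring.
    exact: (subringB hO).
  - move=> y z [Oy Oy'] [Oz Oz']; split; first exact: (subringM hO).
    rewrite rmorphM /=.
    have -> : (y * z - swap y * swap z) / (zvar a - zvar b)
        = (y - swap y) / (zvar a - zvar b) * z
          + swap y * ((z - swap z) / (zvar a - zvar b)) by ring.
    by apply: (subringD hO); apply: (subringM hO) => //; apply: swap_loc.
have T_inv y : O y^-1 -> O y /\ O ((y - swap y) / (zvar a - zvar b)) ->
    O y^-1 /\ O ((y^-1 - swap y^-1) / (zvar a - zvar b)).
  move=> Oy [_ Oy']; split; first exact: Oy.
  have [->|nz_y] := eqVneq y 0.
    by rewrite invr0 rmorph0 subrr mul0r; apply: subring0 hO.
  have nz_sy : swap y != 0 by rewrite fmorph_eq0.
  have -> : (y^-1 - swap y^-1) / (zvar a - zvar b)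
      = - (y^-1 * swap y^-1 * ((y - swap y) / (zvar a - zvar b))).
    rewrite fmorphV /=; exact: (inv_diff_div _ nz_y nz_sy).
  apply: (subringN hO); apply: (subringM hO) => //; apply: (subringM hO) => //.
  exact: swap_loc.
have O_L := @laurent_loc F S n (off_pair a b).
have T_zvar i : O (zvar i) /\ O ((zvar i - swap (zvar i)) / (zvar a - zvar b)).
  split; first by apply/O_L/laurent_zvar.
  have [->|ia] := eqVneq i a.
    by rewrite swap_zvarL divff //; apply: subring1 hO.
  have [->|ib] := eqVneq i b.
    rewrite swap_zvarR -opprB mulNr divff //; apply: (subringN hO).
    exact: subring1 hO.
  rewrite /swap rename_zvar tpermD 1?eq_sym // subrr mul0r.
  exact: subring0 hO.
have T_L y : L y -> O y /\ O ((y - swap y) / (zvar a - zvar b)).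
  move: y; apply: laurent_ind => //.
    move=> c Sc; split; first by apply/O_L/laurent_const.
    by rewrite swap_const subrr mul0r; apply: subring0 hO.
  by move=> i; apply: T_inv => //; apply/O_L/laurent_zvarV.
apply: (loc_ind (@off_pair_neq n a b) hT T_L) Ox => i j Gij.
apply: T_inv; first exact: (loc_inv hS (@off_pair_neq n a b) Gij).
exact: (subringB hT (T_zvar i) (T_zvar j)).
Qed.

(** The ring is spanned by 1 and z_a over its elements fixed by the swap: f2 is the
divided difference of x, and f1 = x - z_a f2. *)
Lemma swap_decomp x : O x -> exists f1 f2,
  [/\ O f1, O f2, swap f1 = f1, swap f2 = f2 & x = f1 + zvar a * f2].
Proof.
move=> Ox; have nz := zvar_diff_neq0 F ab.
have Of2 := swap_div_diff Ox; set f2 := (_ / _) in Of2.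
have ex : swap x = x - (zvar a - zvar b) * f2.
  by rewrite /f2 mulrC divfK // opprB addrC subrK.
have sf2 : swap f2 = f2.
  rewrite {1}/f2 fmorph_div !rmorphB /= swapK swap_zvarL swap_zvarR.
  by rewrite -opprB -[X in _ / X]opprB invrN mulrNN.
exists (x - zvar a * f2), f2; split=> //; last by rewrite subrK.
  apply: (subringB hO) => //; apply: (subringM hO) => //.
  by apply: laurent_loc; apply: laurent_zvar.
by rewrite rmorphB rmorphM /= swap_zvarL sf2 ex; ring.
Qed.

End Swap.

(** * The shuffle kernel and symmetrized products *)

Section Kernel.
Variables (K : fieldType) (q1 q2 : K).
Implicit Types x y f : K.

(** The factor omega of the shuffle product.  It is written over an arbitrary field
so that identities between such fractions are checked on abstract elements. *)
Definition kernel x y :=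
  (x - q1 * q2 * y) * (y - q1 * x) * (y - q2 * x) / (x - y).

Definition rel_quad x y :=
  2 * (q1 * q2) * x ^+ 2
  - (1 + q1 + q2 - 2 * (q1 * q2) + q1 * (q1 * q2) + q2 * (q1 * q2)
     + (q1 * q2) ^+ 2) * x * y
  + 2 * (q1 * q2) * y ^+ 2.

Definition rel_lin x y := (1 - q1) * (1 - q2) * (1 - q1 * q2) * (x + y).

Lemma rel_quadC x y : rel_quad x y = rel_quad y x.
Proof. by rewrite /rel_quad; ring. Qed.

Lemma rel_linC x y : rel_lin x y = rel_lin y x.
Proof. by rewrite /rel_lin; ring. Qed.

(** This is the computation that produces the two generators.  For f2 = 0
it says that omega(x, y) + omega(y, x) is the first one.  For f1 = 0, what is left
beyond (x + y) / 2 times the first one is a multiple of x y (x + y), whose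
coefficient 1 - q1 - q2 + q q1 + q q2 - q^2 factors as (1 - q1)(1 - q2)(1 - q). *)
Lemma kernel_swap_rel x y f1 f2 : x - y != 0 -> 2 != 0 :> K ->
  (f1 + x * f2) * kernel x y + (f1 + y * f2) * kernel y x
  = (f1 + 2^-1 * (f2 * (x + y))) * rel_quad x y
    + 2^-1 * (f2 * x * y) * rel_lin x y.
Proof.
move=> nz_xy nz2; have nz_yx : y - x != 0 by rewrite -opprB oppr_eq0.
rewrite /kernel /rel_quad /rel_lin.
by field; rewrite nz_xy nz_yx nz2.
Qed.

Section Membership.
Variables (T : K -> Prop) (hT : is_subring T) (x y : K).
Hypotheses (Tq1 : T q1) (Tq2 : T q2) (Tx : T x) (Ty : T y).

Ltac subring_closed := repeat first [assumption | apply: (subring1 hT)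
  | apply: (subring_nat hT 2) | apply: (subringB hT) | apply: (subringD hT)
  | apply: (subringM hT) | apply: (subringX hT)].

Lemma rel_quad_in : T (rel_quad x y).
Proof. by rewrite /rel_quad; subring_closed. Qed.

Lemma rel_lin_in : T (rel_lin x y).
Proof. by rewrite /rel_lin; subring_closed. Qed.

Lemma kernel_in : T (x - y)^-1 -> T (kernel x y).
Proof. by rewrite /kernel => ?; subring_closed. Qed.

End Membership.

End Kernel.

Section KernelMorphism.
Variables (K K' : fieldType) (f : {rmorphism K -> K'}) (q1 q2 x y : K).

Lemma rmorph_kernel : f (kernel q1 q2 x y) = kernel (f q1) (f q2) (f x) (f y).
Proof. by rewrite /kernel fmorph_div !(rmorphB, rmorphM). Qed.

Lemma rmorph_rel_quad :
  f (rel_quad q1 q2 x y) = rel_quad (f q1) (f q2) (f x) (f y).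
Proof. by rewrite /rel_quad !(rmorphB, rmorphD, rmorphM, rmorphXn, rmorph1). Qed.

Lemma rmorph_rel_lin :
  f (rel_lin q1 q2 x y) = rel_lin (f q1) (f q2) (f x) (f y).
Proof. by rewrite /rel_lin !(rmorphB, rmorphD, rmorphM, rmorph1). Qed.

End KernelMorphism.

Section Shuffle.
Variables (F : fieldType) (S : F -> Prop) (hS : is_subring S) (q1 q2 : F).
Hypotheses (Sq1 : S q1) (Sq2 : S q2) (nz2 : 2 != 0 :> F).
Hypothesis S_natV : forall m, S (m%:R)^-1.
Local Notation kern n x y := (kernel (rconst n q1) (rconst n q2) x y).
Local Notation relQ n x y := (rel_quad (rconst n q1) (rconst n q2) x y).
Local Notation relL n x y := (rel_lin (rconst n q1) (rconst n q2) x y).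

Definition pair_ideal n (B : ratfun F n -> Prop) (a b : 'I_n) :=
  ideal2 B (relQ n (zvar a) (zvar b)) (relL n (zvar a) (zvar b)).

(** The condition that is stable under shuffle products.  Asking for all the pairs,
and not only for the first two variables, makes it invariant under renaming. *)
Definition in_pair_ideals n (x : ratfun F n) : Prop :=
  forall a b, a != b -> pair_ideal (@laurent F S n) a b x.

Lemma pair_idealC n (B : ratfun F n -> Prop) a b x :
  pair_ideal B a b x -> pair_ideal B b a x.
Proof. by rewrite /pair_ideal rel_quadC rel_linC. Qed.

Lemma rename_pair_ideal m n (v : 'I_m -> 'I_n) (v_inj : injective v)
    (B : ratfun F m -> Prop) (B' : ratfun F n -> Prop) a b x :
    (forall y, B y -> B' (rename v_inj y)) ->
  pair_ideal B a b x -> pair_ideal B' (v a) (v b) (rename v_inj x).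
Proof.
move=> BB' /(ideal2_morph (f := rename v_inj) BB').
by rewrite rmorph_rel_quad rmorph_rel_lin /= !rename_const !rename_zvar.
Qed.

Section Swapping.
Variables (n : nat) (a b : 'I_n).
Hypothesis ab : a != b.
Local Notation L := (@laurent F S n).
Local Notation O := (loc S (off_pair a b)).
Let hL : is_subring L := laurent_subring hS n.
Let hO : is_subring O := loc_subring hS (off_pair a b).

Lemma kernel_loc (G : rel 'I_n) i j : (forall i j, G i j -> i != j) ->
  G i j -> loc S G (kern n (zvar i) (zvar j)).
Proof.
move=> G_neq Gij; have O_L := @laurent_loc F S n G.
apply: (kernel_in (loc_subring hS G)).
- by apply: O_L; apply: laurent_const.
- by apply: O_L; apply: laurent_const.
- by apply: O_L; apply: laurent_zvar.
- by apply: O_L; apply: laurent_zvar.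
- exact: loc_inv.
Qed.

Lemma swap_pair_ideal x :
  pair_ideal O a b x -> pair_ideal O a b (x + swap a b x).
Proof.
move=> h; apply: (ideal2D hO) => //.
have := rename_pair_ideal (v_inj := @perm_inj _ (tperm a b))
  (@swap_loc F S hS n a b) h.
by rewrite tpermL tpermR => /pair_idealC.
Qed.

Lemma ratfun_two_neq0 : 2 != 0 :> ratfun F n.
Proof. by rewrite -(rmorph_nat (@rconst F n)) fmorph_eq0. Qed.

(** Write x = f1 + z_a f2 with f1, f2 fixed by the swap, and use
[kernel_swap_rel]. *)
Lemma swap_kernel x : O x ->
  pair_ideal O a b (x * kern n (zvar a) (zvar b)
                    + swap a b (x * kern n (zvar a) (zvar b))).
Proof.
move=> Ox; have [f1 [f2 [Of1 Of2 s1 s2 ->]]] := swap_decomp hS ab Ox.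
rewrite rmorphM rmorphD rmorphM rmorph_kernel /= !swap_const s1 s2.
rewrite swap_zvarL swap_zvarR kernel_swap_rel; last first.
- exact: ratfun_two_neq0.
- exact: zvar_diff_neq0.
have O_L := @laurent_loc F S n (off_pair a b).
have O2 : O 2^-1.
  rewrite -(rmorph_nat (@rconst F n)) -fmorphV; apply: O_L.
  exact: laurent_const.
have Oz i : O (zvar i) by apply: O_L; apply: laurent_zvar.
exists (f1 + 2^-1 * (f2 * (zvar a + zvar b))), (2^-1 * (f2 * zvar a * zvar b)).
split; last by [].
  apply: (subringD hO) => //; apply: (subringM hO) => //; apply: (subringM hO) => //.
  exact: (subringD hO).
by apply: (subringM hO) => //; apply: (subringM hO) => //; apply: (subringM hO).
Qed.

Lemma swap_kernelC x : O x ->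
  pair_ideal O a b (x * kern n (zvar b) (zvar a)
                    + swap a b (x * kern n (zvar b) (zvar a))).
Proof.
have -> : x * kern n (zvar b) (zvar a)
    = swap a b (swap a b x * kern n (zvar a) (zvar b)).
  by rewrite rmorphM rmorph_kernel /= !swap_const swap_zvarL swap_zvarR swapK.
by rewrite swapK addrC => Ox; apply/swap_kernel/swap_loc.
Qed.

End Swapping.

Section Product.
Variables (k l n : nat) (u : 'I_k -> 'I_n) (w : 'I_l -> 'I_n).
Hypotheses (u_inj : injective u) (w_inj : injective w).
Hypothesis uw_neq : forall i j, u i != w j.
Hypothesis uw_cover : forall c, (exists i, c = u i) \/ (exists j, c = w j).
Variables (P : ratfun F k) (Q : ratfun F l).
Hypotheses (LP : laurent S P) (LQ : laurent S Q).

(** A summand of the symmetrization: the variables of P are placed at the positions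
u, and those of Q at the positions w. *)
Definition placed := rename u_inj P * rename w_inj Q
  * \prod_(i < k) \prod_(j < l) kern n (zvar (u i)) (zvar (w j)).

(** If z_a and z_b are both variables of P, or both of Q, then there is no pole
along z_a = z_b and the factor that contains them is in the ideal.  Otherwise
exactly one factor of the double product has this pole, and [swap_kernel] or
[swap_kernelC] applies to it. *)
Lemma placed_swap a b : in_pair_ideals P -> in_pair_ideals Q -> a != b ->
  pair_ideal (loc S (off_pair a b)) a b (placed + swap a b placed).
Proof.
move=> wP wQ ab; have hO := loc_subring hS (off_pair a b).
have O_L := @laurent_loc F S n (off_pair a b).
have OP : loc S (off_pair a b) (rename u_inj P) by apply/O_L/rename_laurent.
have OQ : loc S (off_pair a b) (rename w_inj Q) by apply/O_L/rename_laurent.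
have Okern i j : off_pair a b (u i) (w j) ->
    loc S (off_pair a b) (kern n (zvar (u i)) (zvar (w j))).
  by apply: kernel_loc; apply: off_pair_neq.
have wu_neq j i : w j != u i by rewrite eq_sym.
have pull_factor (p q e r s : ratfun F n) :
    p * q * (e * r * s) = p * q * r * s * e.
  by ring.
have extract i0 j0 :
    (forall i j, (i, j) != (i0, j0) -> off_pair a b (u i) (w j)) ->
    exists2 x, loc S (off_pair a b) x
      & placed = x * kern n (zvar (u i0)) (zvar (w j0)).
  move=> off; rewrite /placed (bigD1 i0) //= (bigD1 j0) //= pull_factor.
  eexists; last by [].
  apply: (subringM hO); first apply: (subringM hO); first exact: (subringM hO).
    apply: (subring_prod hO) => j jj0; apply/Okern/off.
    by rewrite xpair_eqE (negbTE jj0) andbF.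
  apply: (subring_prod hO) => i ii0; apply: (subring_prod hO) => j _; apply/Okern/off.
  by rewrite xpair_eqE (negbTE ii0).
have all_off : (forall i j, off_pair a b (u i) (w j)) ->
    loc S (off_pair a b)
      (\prod_(i < k) \prod_(j < l) kern n (zvar (u i)) (zvar (w j))).
  move=> off; apply: (subring_prod hO) => i _; apply: (subring_prod hO) => j _.
  by apply/Okern.
have [[i ea]|[j ea]] := uw_cover a; have [[i' eb]|[j' eb]] := uw_cover b.
- apply: swap_pair_ideal; rewrite /placed -mulrA mulrC.
  apply: (ideal2Ml hO).
    apply: (subringM hO) => //; apply: all_off => i1 j1.
    by rewrite /off_pair !xpair_eqE ea eb uw_neq !(negbTE (wu_neq _ _)) !andbF.
  rewrite ea eb; apply: rename_pair_ideal (wP i i' _) => [y Ly|].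
    by apply: laurent_loc; apply: rename_laurent.
  by apply: contraNneq ab => ii'; rewrite ea eb ii'.
- have [|x Ox ->] := extract i j'; last by rewrite -ea -eb; apply: swap_kernel.
  move=> i1 j1; rewrite /off_pair !xpair_eqE ea eb uw_neq.
  rewrite (inj_eq u_inj) (inj_eq w_inj) => -> /=.
  by rewrite (negbTE (uw_neq _ _)).
- have [|x Ox ->] := extract i' j; last by rewrite -ea -eb; apply: swap_kernelC.
  move=> i1 j1; rewrite /off_pair !xpair_eqE ea eb uw_neq.
  rewrite (inj_eq u_inj) (inj_eq w_inj) => -> /=.
  by rewrite (negbTE (uw_neq _ _)).
- apply: swap_pair_ideal; rewrite /placed mulrAC.
  apply: (ideal2Ml hO).
    apply: (subringM hO) => //; apply: all_off => i1 j1.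
    by rewrite /off_pair !xpair_eqE ea eb uw_neq !(negbTE (uw_neq _ _)).
  rewrite ea eb; apply: rename_pair_ideal (wQ j j' _) => [y Ly|].
    by apply: laurent_loc; apply: rename_laurent.
  by apply: contraNneq ab => jj'; rewrite ea eb jj'.
Qed.

End Product.

Lemma Sym_invariant n (x : ratfun F n) (s : 'S_n) :
  rename (@perm_inj _ s) (Defs.Sym x) = Defs.Sym x.
Proof.
rewrite /Defs.Sym rmorph_sum [RHS](reindex_inj (mulIg s)) /=.
apply: eq_bigr => r _.
apply: (rename_comp (@perm_inj _ r) (@perm_inj _ s) (@perm_inj _ (r * s)%g)) => i.
by rewrite /= permM.
Qed.

Section Symmetrization.
Variables (k l : nat) (P : ratfun F k) (Q : ratfun F l).
Hypotheses (LP : laurent S P) (LQ : laurent S Q).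
Hypotheses (wP : in_pair_ideals P) (wQ : in_pair_ideals Q).

Definition sym_product : ratfun F (k + l) :=
  (k`!%:R * l`!%:R)^-1
  * Defs.Sym (placed (@lshift_inj k l) (@rshift_inj k l) P Q).

Lemma rename_placed (s : 'S_(k + l)) :
  rename (@perm_inj _ s) (placed (@lshift_inj k l) (@rshift_inj k l) P Q)
  = placed (inj_comp (@perm_inj _ s) (@lshift_inj k l))
           (inj_comp (@perm_inj _ s) (@rshift_inj k l)) P Q.
Proof.
rewrite /placed 2!rmorphM rmorph_prod /=.
congr (_ * _ * _); [exact: rename_comp|exact: rename_comp|].
apply: eq_bigr => i _; rewrite rmorph_prod; apply: eq_bigr => j _.
by rewrite rmorph_kernel /= !rename_const !rename_zvar.
Qed.

Lemma sym_product_coef n : laurent S ((k`!%:R * l`!%:R)^-1 : ratfun F n).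
Proof.
rewrite -natrM -(rmorph_nat (@rconst F n)) -fmorphV.
exact: laurent_const.
Qed.

(** Twice the symmetrization is the sum of Y + t(Y) over the permuted summands Y,
because the symmetrization is fixed by the swap t. *)
Lemma sym_product_pair_ideal a b : a != b ->
  pair_ideal (loc S (off_pair a b)) a b sym_product.
Proof.
move=> ab; have hO := loc_subring hS (off_pair a b).
have O_L := @laurent_loc F S (k + l) (off_pair a b).
apply: (ideal2Ml hO); first by apply/O_L/sym_product_coef.
have twice (y : ratfun F (k + l)) : y = 2^-1 * (y + y).
  by field; apply: ratfun_two_neq0.
rewrite [Defs.Sym _]twice; apply: (ideal2Ml hO).
  by rewrite -(rmorph_nat (@rconst F _)) -fmorphV; apply/O_L/laurent_const.
(* The second copy of the symmetrization is replaced by its image under the swap. *)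
rewrite -{2}(Sym_invariant _ (tperm a b)) /Defs.Sym rmorph_sum -big_split /=.
apply: (ideal2_sum hO) => s _.
have := rename_placed s; rewrite {1}/rename => ->.
apply: placed_swap => //.
  move=> i j; rewrite /= (inj_eq (@perm_inj _ _)).
  by rewrite eq_lrshift.
move=> c; rewrite -[c](permKV s) /=.
case: (split_ordP (s^-1%g c)) => i ->; [left|right]; by exists i.
Qed.

Lemma sym_product_distinct : loc S (@distinct (k + l)) sym_product.
Proof.
have hD := loc_subring hS (@distinct (k + l)).
have D_L := @laurent_loc F S (k + l) (@distinct (k + l)).
apply: (subringM hD); first by apply/D_L/sym_product_coef.
apply: (subring_sum hD) => s _; have := rename_placed s; rewrite {1}/rename => ->.
apply: (subringM hD).
  by apply: (subringM hD); apply/D_L/rename_laurent.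
apply: (subring_prod hD) => i _; apply: (subring_prod hD) => j _.
apply: kernel_loc => //=.
by rewrite /distinct (inj_eq (@perm_inj _ _)) eq_lrshift.
Qed.

Lemma collapse_stable_rels n (a b : 'I_n) :
  collapse_stable S a b (relQ n (zvar a) (zvar b))
  /\ collapse_stable S a b (relL n (zvar a) (zvar b)).
Proof.
have h := collapse_stable_subring hS a b.
split; [apply: (rel_quad_in h)|apply: (rel_lin_in h)];
  try exact: collapse_stable_const;
  by apply: (collapse_stable_zvar hS); rewrite eqxx ?orbT.
Qed.

(** Membership in the ideal of a pair, over the ring localized away from that pair,
excludes a pole along that pair; so integrality comes with no separate argument. *)
Lemma sym_product_laurent : laurent S sym_product.
Proof.
apply: (laurent_of_loc hS sym_product_distinct) => a b ab.
have hO := loc_subring hS (off_pair a b).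
have O_L := @laurent_loc F S (k + l) (off_pair a b).
apply: (ideal2_sub hO) (sym_product_pair_ideal ab);
  [apply: (rel_quad_in hO)|apply: (rel_lin_in hO)];
  apply: O_L; try exact: laurent_const; exact: laurent_zvar.
Qed.

Lemma sym_product_in_pair_ideals : in_pair_ideals sym_product.
Proof.
move=> a b ab; have [st1 st2] := collapse_stable_rels a b.
exact: (loc_ideal2 hS st1 st2 sym_product_laurent (sym_product_pair_ideal ab)).
Qed.

Lemma sym_product_symmetric : rsymmetric sym_product.
Proof.
move=> s; change (rename (@perm_inj _ s) sym_product = sym_product).
rewrite rmorphM /= Sym_invariant; congr (_ * _).
by rewrite fmorphV rmorphM !rmorph_nat.
Qed.

End Symmetrization.
End Shuffle.

(** * The subalgebra of families in all the pair ideals *)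

Section Graded.
Variable R : realType.
Local Notation in_pair_idealsR := (@in_pair_ideals (qfield R) (@Rq R) q1 q2 _).

Lemma Rq_subring : is_subring (@Rq R).
Proof. exact: laurent_subring. Qed.

Lemma Rq_q1 : Rq (q1 : qfield R).
Proof. exact: laurent_zvar. Qed.

Lemma Rq_q2 : Rq (q2 : qfield R).
Proof. exact: laurent_zvar. Qed.

Lemma Rq_natV m : Rq (m%:R^-1 : qfield R).
Proof.
rewrite -(rmorph_nat (@rconst R[i] 2)) -fmorphV.
exact: laurent_const.
Qed.

Lemma qfield_two_neq0 : 2 != 0 :> qfield R.
Proof.
by rewrite -(rmorph_nat (@rconst R[i] 2)) fmorph_eq0 pnatr_eq0.
Qed.

Definition admissible n (P : zfield R n) : Prop :=
  symLaurent P /\ in_pair_idealsR P.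

Lemma rsymmetricE n (P : zfield R n) :
  rsymmetric P <-> forall s : 'S_n, rename (@perm_inj _ s) P = P.
Proof. by []. Qed.

Lemma admissible0 n : admissible (0 : zfield R n).
Proof.
have hL := laurent_subring Rq_subring n.
split; last by move=> a b _; apply: ideal2_0 hL _ _.
by split; [exact: subring0 hL | apply/rsymmetricE => s; rewrite rmorph0].
Qed.

Lemma admissibleD n (P Q : zfield R n) :
  admissible P -> admissible Q -> admissible (P + Q).
Proof.
have hL := laurent_subring Rq_subring n.
move=> [[LP sP] wP] [[LQ sQ] wQ]; split; last first.
  by move=> a b ab; apply: (ideal2D hL); [apply: wP|apply: wQ].
split; first exact: (subringD hL).
move/rsymmetricE: sP => sP; move/rsymmetricE: sQ => sQ.
by apply/rsymmetricE => s; rewrite rmorphD /= sP sQ.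
Qed.

Lemma admissible_scale n c (P : zfield R n) :
  Rq c -> admissible P -> admissible (rconst n c * P).
Proof.
have hL := laurent_subring Rq_subring n.
move=> Rc [[LP sP] wP].
have Lc : laurentR (rconst n c) by apply: (laurent_const Rq_subring).
split; last by move=> a b ab; apply: (ideal2Ml hL) => //; apply: wP.
split; first exact: (subringM hL).
move/rsymmetricE: sP => sP.
by apply/rsymmetricE => s; rewrite rmorphM /= rename_const sP.
Qed.

Lemma omegaE n (x y : zfield R n) :
  omega x y = kernel (rconst n q1) (rconst n q2) x y.
Proof. by rewrite /omega /kernel /q rmorphM. Qed.

Lemma shuffleE k l (P : zfield R k) (Q : zfield R l) :
  shuffle P Q = sym_product q1 q2 P Q.
Proof.
rewrite /shuffle /sym_product /placed; congr (_ * Defs.Sym (_ * _)).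
by apply: eq_bigr => i _; apply: eq_bigr => j _; rewrite omegaE.
Qed.

Lemma admissible_shuffle k l (P : zfield R k) (Q : zfield R l) :
  admissible P -> admissible Q -> admissible (shuffle P Q).
Proof.
move=> [[LP sP] wP] [[LQ sQ] wQ]; rewrite shuffleE.
have S2 := qfield_two_neq0; have SV := Rq_natV; have hS := Rq_subring.
have S1 := Rq_q1; have Sq2 := Rq_q2.
split; last exact: sym_product_in_pair_ideals.
by split; [exact: sym_product_laurent | exact: sym_product_symmetric].
Qed.

Lemma shuffle0l k l (Q : zfield R l) : shuffle (0 : zfield R k) Q = 0.
Proof.
rewrite /shuffle /Defs.Sym big1 ?mulr0 // => s _.
have -> : rsubst (fun i => zvar (lshift l i)) (0 : zfield R k) = 0.
  exact: (rmorph0 (rename (@lshift_inj k l))).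
by rewrite !mul0r; exact: (rmorph0 (rename (@perm_inj _ s))).
Qed.

Lemma shuffle0r k l (P : zfield R k) : shuffle P (0 : zfield R l) = 0.
Proof.
rewrite /shuffle /Defs.Sym big1 ?mulr0 // => s _.
have -> : rsubst (fun j => zvar (rshift k j)) (0 : zfield R l) = 0.
  exact: (rmorph0 (rename (@rshift_inj k l))).
by rewrite mulr0 mul0r; exact: (rmorph0 (rename (@perm_inj _ s))).
Qed.

(** The transport in [indeg] is along a proof of k = k. *)
Lemma indeg_self k (P : zfield R k) : indeg P k = P.
Proof. by rewrite /indeg; case: eqP => // e; rewrite eq_axiomK. Qed.

Lemma indeg_neq k (P : zfield R k) n : k <> n -> indeg P n = 0.
Proof. by rewrite /indeg; case: eqP. Qed.

Lemma indeg0 k n : indeg (0 : zfield R k) n = 0.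
Proof.
have [e|/eqP ne] := eqVneq k n; last by rewrite indeg_neq.
by case: n / e; rewrite indeg_self.
Qed.

Lemma admissible_indeg k (P : zfield R k) n :
  admissible P -> admissible (indeg P n).
Proof.
move=> gP; have [e|/eqP ne] := eqVneq k n.
  by case: n / e; rewrite indeg_self.
by rewrite indeg_neq //; apply: admissible0.
Qed.

Definition admissible_family (f : graded R) : Prop :=
  (exists N, forall n, (N <= n)%N -> f n = 0) /\ forall n, admissible (f n).

Lemma admissible_family_indeg k (P : zfield R k) :
  admissible P -> admissible_family (indeg P).
Proof.
move=> gP; split; last by move=> n; apply: admissible_indeg.
by exists k.+1 => n kn; apply: indeg_neq => e; rewrite e ltnn in kn.
Qed.

(** With at most one variable there are no pairs and no nontrivial permutations. *)
Lemma admissible_small k (P : zfield R k) :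
  (k <= 1)%N -> laurentR P -> admissible P.
Proof.
move=> k1 LP; have triv (i j : 'I_k) : i = j.
  apply: val_inj; case: i j => [[|i] hi] [[|j] hj] //=;
    by case: k k1 hi hj {P LP} => [|[|k]].
split; last by move=> a b; rewrite (triv a b) eqxx.
split=> //.
apply/rsymmetricE => s; have -> : s = 1%g by apply/permP => i; apply: triv.
apply: (@ratfun_morph_eq _ _ k (rename (@perm_inj _ 1%g)) idfun) => [c|i] /=.
  exact: rename_const.
by rewrite rename_zvar perm1.
Qed.

Lemma admissible_family_subalgebra : subalgebra admissible_family.
Proof.
split.
- by move=> f [fN gf]; split=> // n; case: (gf n).
- apply: admissible_family_indeg; apply: admissible_small => //.
  exact: subring1 (laurent_subring Rq_subring 0).
- move=> f g [[N fN] gf] [[M gM] gg]; split; last by move=> n; apply: admissibleD.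
  exists (maxn N M) => n; rewrite geq_max => /andP[Nn Mn].
  by rewrite /gadd fN // gM // addr0.
- move=> c f Rc [[N fN] gf]; split; last by move=> n; apply: admissible_scale.
  by exists N => n Nn; rewrite /gscale fN // mulr0.
move=> f g [[N fN] gf] [[M gM] gg]; split.
  exists (N + M)%N => n NMn; rewrite /gmul big1 // => i _; rewrite big1 // => j _.
  have [Ni|iN] := leqP N i; first by rewrite fN // shuffle0l indeg0.
  have [Mj|jM] := leqP M j; first by rewrite gM // shuffle0r indeg0.
  apply: indeg_neq => e; move: NMn; rewrite -e leqNgt -addSn leq_add //.
  exact: ltnW.
move=> n; rewrite /gmul.
apply: big_ind; [exact: admissible0|exact: admissibleD|move=> i _].
apply: big_ind; [exact: admissible0|exact: admissibleD|move=> j _].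
by apply/admissible_indeg/admissible_shuffle.
Qed.

Lemma admissible_zpow d : admissible_family (@zpow R d).
Proof.
apply: admissible_family_indeg; apply: admissible_small => //.
have hL := laurent_subring Rq_subring 1.
case: d => m; first exact/(subringX hL)/(laurent_zvar Rq_subring).
rewrite NegzE -exprz_inv; apply: (subringX hL); exact: (laurent_zvarV Rq_subring).
Qed.

End Graded.

Theorem theorem1p2 (R : realType) (k : nat) (hk : (2 <= k)%N)
    (P : zfield R k) :
  let c : qfield R -> zfield R k := rconst k in
  let z1 : zfield R k := zvar (Ordinal (ltnW hk)) in
  let z2 : zfield R k := zvar (Ordinal hk) in
  Ak P ->
  in_ideal2
    (c (2 * q) * z1 ^+ 2
     - c (1 + q1 + q2 - 2 * q + q1 * q + q2 * q + q ^+ 2) * z1 * z2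
     + c (2 * q) * z2 ^+ 2)
    (c ((1 - q1) * (1 - q2) * (1 - q)) * (z1 + z2))
    P.
Proof.
move=> c z1 z2 [_ AP].
have [_ gP] := AP _ (admissible_family_subalgebra R) (@admissible_zpow R).
have [_ wP] := gP k; rewrite indeg_self in wP.
have := wP (Ordinal (ltnW hk)) (Ordinal hk) isT.
rewrite /pair_ideal /rel_quad /rel_lin -/z1 -/z2.
rewrite /c /q !(rmorphB, rmorphD, rmorphM, rmorphXn, rmorph1) /=.
exact.
Qed.
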